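(* Let $n\ge 2$, let $(L,[\cdot,\dots,\cdot],\varepsilon,\alpha)$ be an $n$-Hom-Lie color algebra and let $\xi\in L_e$ be such that $\alpha(\xi)=\xi$. Define $\{x_1,\dots,x_{n-1}\}=[\xi,x_1,\dots,x_{n-1}]$ for $x_1,\dots,x_{n-1}\in L$. Then $(L,\{\cdot,\dots,\cdot\},\varepsilon,\alpha)$ is an $(n-1)$-Hom-Lie color algebra.
   Context: $G$ is an abelian group with neutral element $e$ (operation written $+$), $\mathbb{K}$ is a field of characteristic different from 2. A $G$-graded linear space is $V=\bigoplus_{a\in G}V_a$ over $\mathbb{K}$; $\mathcal{H}(V)$ is its set of homogeneous elements; a linear map $f:V\to V'$ is even if $f(V_a)\subseteq V'_a$ for all $a$. A (skew-symmetric) bicharacter is a map $\varepsilon:G\times G\to\mathbb{K}^*$ with $\varepsilon(a,b)\varepsilon(b,a)=1$, $\varepsilon(a,b+c)=\varepsilon(a,b)\varepsilon(a,c)$, $\varepsilon(a+b,c)=\varepsilon(a,c)\varepsilon(b,c)$. For homogeneous $x,y$ one writes $\varepsilon(x,y)$ for $\varepsilon(\deg x,\deg y)$, and sums of homogeneous elements inside $\varepsilon$ denote sums of their degrees. For an integer $n\ge1$, an $n$-Hom-Lie color algebra $(L,[\cdot,\dots,\cdot],\varepsilon,\alpha)$ is a $G$-graded linear space $L$ with an $n$-linear map $[\cdot,\dots,\cdot]:L^n\to L$, a bicharacter $\varepsilon$ and an even linear map $\alpha:L\to L$ such that for all $x_i,y_j\in\mathcal{H}(L)$: (1) $[x_1,\dots,x_i,x_{i+1},\dots,x_n]=-\varepsilon(x_i,x_{i+1})[x_1,\dots,x_{i+1},x_i,\dots,x_n]$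 for $1\le i\le n-1$; (2) $[\alpha(x_1),\dots,\alpha(x_{n-1}),[y_1,\dots,y_n]]=\sum_{i=1}^n\varepsilon(X,Y_i)[\alpha(y_1),\dots,\alpha(y_{i-1}),[x_1,\dots,x_{n-1},y_i],\alpha(y_{i+1}),\dots,\alpha(y_n)]$, where $X=x_1+\dots+x_{n-1}$, $Y_i=y_1+\dots+y_{i-1}$ (sums of degrees, $Y_1=e$). *)

(* Defs.v *)
From HB Require Import structures.
From mathcomp Require Import all_boot all_order all_fingroup all_algebra.
From mathcomp Require Import boolp classical_sets.

Set Implicit Arguments.
Unset Strict Implicit.
Unset Printing Implicit Defensive.

Import GRing.Theory.
Local Open Scope ring_scope.

(* [L] is the internal direct sum of the subspaces [L_ a], [a : G]. *)
Definition is_grading (G : zmodType) (K : fieldType) (L : lmodType K)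
    (L_ : G -> set L) : Prop :=
  [/\ forall a, GRing.submod_closed [in L_ a],
      forall v, exists (s : seq G) (f : G -> L),
        (forall a, f a \in L_ a) /\ v = \sum_(a <- s) f a
    & forall (s : seq G) (f : G -> L), uniq s -> (forall a, f a \in L_ a) ->
        \sum_(a <- s) f a = 0 -> forall a, a \in s -> f a = 0].

Definition is_even (G : zmodType) (K : fieldType) (L L' : lmodType K)
    (L_ : G -> set L) (L'_ : G -> set L') (f : L -> L') : Prop :=
  forall a v, v \in L_ a -> f v \in L'_ a.

Definition is_bicharacter (G : zmodType) (K : fieldType) (eps : G -> G -> K)
    : Prop :=
  [/\ forall a b, eps a b != 0,
      forall a b, eps a b * eps b a = 1,
      forall a b c, eps a (b + c) = eps a b * eps a c
    & forall a b c, eps (a + b) c = eps a c * eps b c].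

Definition tuple_upd (T : Type) (n : nat) (x : n.-tuple T) (i : 'I_n) (v : T)
    : n.-tuple T :=
  [tuple if j == i then v else tnth x j | j < n].

Definition is_multilinear (K : fieldType) (L M : lmodType K) (n : nat)
    (f : n.-tuple L -> M) : Prop :=
  forall (x : n.-tuple L) (i : 'I_n), linear (fun v => f (tuple_upd x i v)).

(* [x] consists of homogeneous elements, of degrees listed by [d].  The zero
   vector has every degree; this is harmless in the two identities below, since
   all their terms vanish as soon as one of the arguments is zero. *)
Definition has_degrees (G : zmodType) (K : fieldType) (L : lmodType K)
    (L_ : G -> set L) (n : nat) (x : n.-tuple L) (d : 'I_n -> G) : Prop :=
  forall i, tnth x i \in L_ (d i).

Definition color_skew_symmetric (G : zmodType) (K : fieldType)
    (L : lmodType K) (L_ : G -> set L) (eps : G -> G -> K) (n : nat)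
    (br : n.-tuple L -> L) : Prop :=
  forall (x : n.-tuple L) (d : 'I_n -> G), has_degrees L_ x d ->
  forall i j : 'I_n, j = i.+1 :> nat ->
    br x = - (eps (d i) (d j) *: br [tuple tnth x (tperm i j k) | k < n]).

Definition hom_nambu_filippov (G : zmodType) (K : fieldType)
    (L : lmodType K) (L_ : G -> set L) (eps : G -> G -> K) (alpha : L -> L)
    (m : nat) (br : m.+1.-tuple L -> L) : Prop :=
  forall (x : m.-tuple L) (dx : 'I_m -> G)
         (y : m.+1.-tuple L) (dy : 'I_m.+1 -> G),
  has_degrees L_ x dx -> has_degrees L_ y dy ->
    br [tuple of rcons (map alpha x) (br y)] =
    \sum_(i < m.+1)
      eps (\sum_(k < m) dx k) (\sum_(k < m.+1 | (k < i)%N) dy k) *: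
      br (tuple_upd [tuple of map alpha y] i
            (br [tuple of rcons x (tnth y i)])).

(* The arity, the n >= 1 of an n-Hom-Lie color algebra, is [m.+1].  The
   bracket is multilinear but is not assumed to be compatible with the grading. *)
Definition is_hom_lie_color_algebra (G : zmodType) (K : fieldType)
    (L : lmodType K) (L_ : G -> set L) (m : nat) (br : m.+1.-tuple L -> L)
    (eps : G -> G -> K) (alpha : {linear L -> L}) : Prop :=
  [/\ is_grading L_, is_multilinear br, is_bicharacter eps,
      is_even L_ L_ alpha
    & color_skew_symmetric L_ eps br /\ hom_nambu_filippov L_ eps alpha br].

(* Main.v *)
(* Apply both axioms of [L] to the tuples [xi :: x] and [xi :: y]: as [xi] has
   degree 0, it does not change the colour factors, and the only term of the
   Hom-Nambu-Filippov sum without a counterpart contains the bracket of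
   [xi, x_1, ..., x_n, xi].  That bracket vanishes: adjacent transpositions bring
   the two copies of [xi] next to each other, where skew-symmetry together with
   [eps 0 0 = 1] and [2 != 0] gives 0. *)
Require Import Defs.
From HB Require Import structures.
From mathcomp Require Import all_boot all_order all_fingroup all_algebra.
From mathcomp Require Import boolp classical_sets.
From mathcomp Require Import zify.

Set Implicit Arguments.
Unset Strict Implicit.
Unset Printing Implicit Defensive.

Import GRing.Theory.
Local Open Scope ring_scope.

Lemma tuple_upd_cons (T : Type) (n : nat) (a : T) (x : n.-tuple T) (i : 'I_n)
    (v : T) :
  tuple_upd [tuple of a :: x] (lift ord0 i) v = [tuple of a :: tuple_upd x i v].
Proof.
apply: eq_from_tnth => j; rewrite tnth_mktuple.
case: (unliftP ord0 j) => [k|] ->; last by rewrite !tnth0.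
by rewrite !tnthS tnth_mktuple (inj_eq lift_inj).
Qed.

Lemma multilinear_linear0 (K : fieldType) (L M : lmodType K) (n : nat)
    (f : n.-tuple L -> M) (x : n.-tuple L) (i : 'I_n) :
  is_multilinear f -> f (tuple_upd x i 0) = 0.
Proof.
(* With scalar $-1$ and both vectors zero, linearity writes the value at $0$ as its own negative
   plus itself. *)
move=> /(_ x i (-1) 0 0); rewrite /= scaler0 addr0 => ->.
by rewrite scaleN1r addNr.
Qed.

Lemma multilinear_cons (K : fieldType) (L M : lmodType K) (n : nat)
    (f : n.+1.-tuple L -> M) (a : L) :
  is_multilinear f -> is_multilinear (fun x : n.-tuple L => f [tuple of a :: x]).
Proof.
move=> linf x i c u v; rewrite -!tuple_upd_cons; exact: linf.
Qed.

Section ColorSkewSymmetry.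
Variables (G : zmodType) (K : fieldType) (L : lmodType K) (L_ : G -> set L).
Variable eps : G -> G -> K.

(** Counterpart of [cons] for degrees, which are functions on ordinals rather than tuples. *)
Definition cons_degree (n : nat) (a : G) (d : 'I_n -> G) (k : 'I_n.+1) : G :=
  if unlift ord0 k is Some j then d j else a.

Lemma cons_degree0 (n : nat) a (d : 'I_n -> G) : cons_degree a d ord0 = a.
Proof. by rewrite /cons_degree unlift_none. Qed.

Lemma cons_degreeS (n : nat) a (d : 'I_n -> G) i :
  cons_degree a d (lift ord0 i) = d i.
Proof. by rewrite /cons_degree liftK. Qed.

Lemma has_degrees_cons (n : nat) (u : L) a (x : n.-tuple L) (d : 'I_n -> G) :
  u \in L_ a -> has_degrees L_ x d ->
  has_degrees L_ [tuple of u :: x] (cons_degree a d).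
Proof.
move=> ua xd k; case: (unliftP ord0 k) => [j|] ->.
  by rewrite cons_degreeS tnthS.
by rewrite cons_degree0 tnth0.
Qed.

Lemma has_degrees_rcons (n : nat) (u : L) a (x : n.-tuple L) (d : 'I_n -> G) :
  u \in L_ a -> has_degrees L_ x d ->
  has_degrees L_ [tuple of rcons x u]
    (fun k => if unlift ord_max k is Some j then d j else a).
Proof.
move=> ua xd k; case: (unliftP ord_max k) => [j|] ->.
  have -> // : tnth [tuple of rcons x u] (lift ord_max j) = tnth x j.
  by rewrite !(tnth_nth u) lift_max /= nth_rcons size_tuple ltn_ord.
by rewrite (tnth_nth 0) /= nth_rcons size_tuple ltnn eqxx.
Qed.

Lemma color_skew_symmetric_cons (n : nat) (br : n.+1.-tuple L -> L) (u : L) a :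
  u \in L_ a -> color_skew_symmetric L_ eps br ->
  color_skew_symmetric L_ eps (fun x : n.-tuple L => br [tuple of u :: x]).
Proof.
move=> ua skew x d xd i j ij.
rewrite (skew _ _ (has_degrees_cons ua xd) (lift ord0 i) (lift ord0 j)); last first.
  by rewrite !lift0 ij.
rewrite !cons_degreeS; congr (- (_ *: br _)); apply: eq_from_tnth => k.
rewrite tnth_mktuple; case: (unliftP ord0 k) => [l|] ->.
  (* The injection [lift ord0] carries the transposition of [i] and [j] to that of their shifts. *)
  by rewrite -inj_tperm ?tnthS ?tnth_mktuple //; apply: lift_inj.
by rewrite tpermD ?tnth0 // eq_sym neq_lift.
Qed.

(** Induction on the gap $j-i$: moving the second copy one place left costs only a scalar factor.
    The tuple, its degrees and [j] change along the way, while [i] stays fixed. *)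
Lemma color_skew_symmetric_eq0 (n : nat) (br : n.-tuple L -> L)
    (x : n.-tuple L) (d : 'I_n -> G) (i j : 'I_n) :
  2%N \notin [pchar K] -> color_skew_symmetric L_ eps br ->
  has_degrees L_ x d -> (i < j)%N ->
  tnth x i = tnth x j -> d i = d j -> eps (d i) (d i) = 1 -> br x = 0.
Proof.
move=> charK skew; move eqm: (j - i)%N => m.
elim: m => [|m IHm] in x d j eqm * => xd ltij xij dij dii.
  by move: ltij; rewrite -subn_gt0 eqm.
(* Gap 1: the swap fixes [x] and its factor is 1, so [br x] equals its own negative and vanishes as
   $2\neq 0$. *)
case: m => [|m] in IHm eqm *.
  have ij : j = i.+1 :> nat by rewrite -(subnK (ltnW ltij)) eqm.
  have := skew _ _ xd _ _ ij; rewrite -dij dii scale1r.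
  have -> : [tuple tnth x (tperm i j k) | k < n] = x.
    by apply: eq_from_tnth => k; rewrite tnth_mktuple; case: tpermP => // ->.
  move/eqP; rewrite -addr_eq0 -mulr2n -scaler_nat scaler_eq0 => /orP[|/eqP //].
  by move=> two0; rewrite inE two0 in charK.
have ltpj : (j.-1 < n)%N by apply: leq_ltn_trans (leq_pred _) (ltn_ord j).
have jp : j = (Ordinal ltpj).+1 :> nat by rewrite /= prednK //; case: (j : nat) ltij.
rewrite (skew _ _ xd _ _ jp); set p := Ordinal _ in jp *.
have eqpi : (p - i)%N = m.+1 by move: eqm; rewrite jp; lia.
have ltip : (i < p)%N by rewrite -subn_gt0 eqpi.
have ti : tperm p j i = i by rewrite tpermD // -val_eqE /= gtn_eqF.
(* After the swap the second copy sits at [p], that is $j-1$, and the degrees are permuted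
   likewise. *)
rewrite (IHm _ (d \o tperm p j) p) ?scaler0 ?oppr0 //=.
- by move=> k; rewrite tnth_mktuple; apply: xd.
- by rewrite !tnth_mktuple ti tpermL.
- by rewrite ti tpermL.
- by rewrite ti.
Qed.

End ColorSkewSymmetry.

(** The value $\varepsilon(a,0)=\varepsilon(a,0+0)$ is a nonzero idempotent of the field. *)
Lemma bicharacter0r (G : zmodType) (K : fieldType) (eps : G -> G -> K) (a : G) :
  is_bicharacter eps -> eps a 0 = 1.
Proof.
case=> nz _ epsD _; apply: (mulfI (nz a 0)).
by rewrite -epsD addr0 mulr1.
Qed.

Lemma hom_nambu_filippov_cons (G : zmodType) (K : fieldType) (L : lmodType K)
    (L_ : G -> set L) (eps : G -> G -> K) (alpha : L -> L) (n : nat)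
    (br : n.+2.-tuple L -> L) (xi : L) :
  2%N \notin [pchar K] -> is_multilinear br -> is_bicharacter eps ->
  color_skew_symmetric L_ eps br -> hom_nambu_filippov L_ eps alpha br ->
  xi \in L_ 0 -> alpha xi = xi ->
  hom_nambu_filippov L_ eps alpha
    (fun x : n.+1.-tuple L => br [tuple of xi :: x]).
Proof.
move=> charK linbr bichar skew hnf xi0 alpha_xi x dx y dy xdx ydy.
have xdx' := has_degrees_cons xi0 xdx.
have ydy' := has_degrees_cons xi0 ydy.
have map_cons k (z : k.-tuple L) :
    [tuple of map alpha [tuple of xi :: z]] = [tuple of xi :: map alpha z].
  by apply: val_inj; rewrite /= alpha_xi.
have -> : [tuple of xi :: [tuple of rcons (map alpha x) (br [tuple of xi :: y])]]
        = [tuple of rcons (map alpha [tuple of xi :: x]) (br [tuple of xi :: y])].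
  by apply: val_inj; rewrite /= alpha_xi.
(* The split-off term is the one whose inner bracket takes the leading [xi] of the second tuple as
   last argument. *)
rewrite (hnf _ _ _ _ xdx' ydy') big_ord_recl.
have -> :
    br [tuple of rcons [tuple of xi :: x] (tnth [tuple of xi :: y] ord0)] = 0.
  have degs := has_degrees_rcons xi0 xdx'.
  (* Position 0 is not the last one, so its degree is the one prepended for [xi]. *)
  have deg0 : (if unlift ord_max (@ord0 n.+1) is Some k
               then cons_degree 0 dx k else 0) = 0.
    case: unliftP => // k k0.
    have -> : k = ord0.
      by apply: (@lift_inj _ ord_max); rewrite -k0; apply: val_inj.
    exact: cons_degree0.
  apply: (color_skew_symmetric_eq0 (i := ord0) (j := ord_max) charK skew degs).
  - by [].
  - by rewrite !(tnth_nth 0) /= nth_rcons size_tuple ltnn eqxx.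
  - by rewrite deg0 unlift_none.
  - by rewrite deg0; apply: bicharacter0r.
rewrite multilinear_linear0 // scaler0 add0r; apply: eq_bigr => i _.
rewrite map_cons tuple_upd_cons tnthS.
congr (eps _ _ *: br [tuple of _ :: tuple_upd _ _ (br _)]).
- rewrite big_ord_recl cons_degree0 add0r.
  by apply: eq_bigr => k _; rewrite cons_degreeS.
(* Position 0 precedes every shifted index, so [xi] does enter this sum, with degree 0. *)
- rewrite big_mkcond big_ord_recl /= cons_degree0 add0r [RHS]big_mkcond.
  by apply: eq_bigr => k _; rewrite cons_degreeS.
- exact: val_inj.
Qed.

Theorem proposition3p1 (G : zmodType) (K : fieldType)
  (charK : 2%N \notin [pchar K])
  (L : lmodType K) (L_ : G -> set L) (n : nat)
  (br : n.+2.-tuple L -> L) (eps : G -> G -> K) (alpha : {linear L -> L})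
  (algL : is_hom_lie_color_algebra L_ br eps alpha)
  (xi : L) (xi_deg : xi \in L_ 0) (alpha_xi : alpha xi = xi) :
  is_hom_lie_color_algebra L_
    (fun x : n.+1.-tuple L => br [tuple of xi :: x]) eps alpha.
Proof.
have [grL linbr bichar evena [skew hnf]] := algL.
split=> //; first exact: multilinear_cons.
split; first exact: color_skew_symmetric_cons xi_deg skew.
exact: hom_nambu_filippov_cons.
Qed.
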